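(* Let $p>0$, $q_1>0$, $q_2>0$ with $p+q_1+q_2=1$, and let $X_1,X_2,\ldots$ be independent random variables with $P(X_i=0)=p$, $P(X_i=+1)=q_1$, $P(X_i=-1)=q_2$. Let $\tau_m$ be the first hitting time of an at most $1+1$ contaminated run of length $m$, let $A_1=A_{1,m}$ be the event that $X_1,\ldots,X_m$ is an at most $1+1$ contaminated run, and let $\alpha=\alpha(m)$ be the number defined in the context. Then, for every $x>0$, $$P\bigl(\tau_m\,\alpha\,P(A_1)>x\bigr)\sim e^{-x}\qquad\text{as } m\to\infty,$$ that is, the ratio of the two sides tends to $1$ as $m\to\infty$.
   Context: The outcome $0$ is called success, $+1$ failure of type I, $-1$ failure of type II. A finite block of consecutive terms $X_n,X_{n+1},\ldots,X_{n+m-1}$ is called an at most $1+1$ contaminated run of length $m$ if it contains at most one value $+1$ and at most one value $-1$ (all other values being $0$). The first hitting time $\tau_m$ is the number of trials at which such a run of length $m$ is first completed, i.e. the smallest $n\ge m$ such that $X_{n-m+1},\ldots,X_n$ is an at most $1+1$ contaminated run. One has $$P(A_1)=p^m+m(1-p)p^{m-1}+m(m-1)p^{m-2}q_1q_2 .$$ For $m\ge 2$, $$\alpha=\frac{C_0+\frac1m C_1+\frac{1}{m(m-1)}C_2}{1+\frac{p(1-p)}{(m-1)q_1q_2}+\frac{p^2}{m(m-1)q_1q_2}},$$ where $$C_0=q_1+q_2,\qquad C_1=\frac{p(q_1^2+q_2^2)}{q_1q_2}-1,\qquad C_2=\frac{(q_1^2+q_2^2)p^2}{q_1q_2(p-1)}+\frac{p}{p-1}+\frac{2(2p+1)q_1q_2}{(p-1)^3}.$$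 *)

(* Defs.v *)
From HB Require Import structures.
From mathcomp Require Import all_boot all_order all_algebra.
From mathcomp Require Import all_classical all_reals all_analysis.

Set Implicit Arguments.
Unset Strict Implicit.
Unset Printing Implicit Defensive.

Import Order.TTheory GRing.Theory Num.Theory numFieldNormedType.Exports.

Local Open Scope classical_set_scope.
Local Open Scope ring_scope.

Section RandomVariables.
Context d (T : measurableType d) (R : realType) (P : probability T R).

(* Mutual independence: the product rule over every finite set of indices,
   given as a duplicate-free list. *)
Definition mutually_independent (X : nat -> {RV P >-> R}) : Prop :=
  forall (J : seq nat) (B : nat -> set R), uniq J ->
    (forall i, measurable (B i)) ->
    P (\bigcap_(i in [set` J]) X i @^-1` B i)
      = (\prod_(i <- J) P (X i @^-1` B i))%E.

(* Trials are numbered from 0: [X i] is the outcome of trial number [i + 1],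
   and [block X k m w] lists the outcomes of trials [k + 1], ..., [k + m]. *)
Definition block (X : nat -> {RV P >-> R}) (k m : nat) (w : T) : seq R :=
  [seq X i w | i <- iota k m].

Definition contaminated_run (s : seq R) : bool :=
  [&& (count_mem 1%R s <= 1)%N, (count_mem (-1)%R s <= 1)%N
    & all (fun v : R => v \in [:: 0; 1; -1]) s].

(* The least [n >= m] such that trials [n - m + 1], ..., [n] form a run; the
   infimum is [+oo] at the sample points where no such [n] exists. *)
Definition hitting_time (X : nat -> {RV P >-> R}) (m : nat) (w : T) : \bar R :=
  ereal_inf [set n%:R%:E | n in
    [set n | (m <= n)%N /\ contaminated_run (block X (n - m) m w)]].

Definition event_A1 (X : nat -> {RV P >-> R}) (m : nat) : set T :=
  [set w | contaminated_run (block X 0 m w)].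

End RandomVariables.

Section Alpha.
Context (R : realType) (p q1 q2 : R).

Definition C0 : R := q1 + q2.

Definition C1 : R := p * (q1 ^+ 2 + q2 ^+ 2) / (q1 * q2) - 1.

Definition C2 : R :=
  (q1 ^+ 2 + q2 ^+ 2) * p ^+ 2 / (q1 * q2 * (p - 1)) + p / (p - 1)
  + 2 * (2 * p + 1) * (q1 * q2) / (p - 1) ^+ 3.

(* Meaningful for [2 <= m] only: for smaller [m] some denominators vanish. *)
Definition alpha (m : nat) : R :=
  (C0 + C1 / m%:R + C2 / (m%:R * (m%:R - 1)))
  / (1 + p * (1 - p) / ((m%:R - 1) * (q1 * q2))
       + p ^+ 2 / (m%:R * (m%:R - 1) * (q1 * q2))).

End Alpha.

(* Main.v *)
Require Import Defs.
From HB Require Import structures.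
From mathcomp Require Import all_boot all_order all_algebra.
From mathcomp Require Import all_classical all_reals all_analysis.
From mathcomp Require Import ring lra.

(** Call a clump start a nonzero letter followed by a window of length [m] with
    exactly one [1] and one [-1]; its probability [u] is
    [(1 - p) m (m - 1) q1 q2 p^(m - 2)], which is asymptotically
    [alpha P(A1)].  Sliding a run to the left over successes, one meets a clump
    start, the beginning of the sequence, or a window with at most one nonzero
    letter; the last two are negligible, the second one having probability
    [P(A1)] and the third one [O(m p^m) = o(u)] per window.  Hence [tau_m > n] is
    asymptotically the absence of clump starts among the first [n] positions.
    Two overlapping clump starts are unlikely: the second one begins at a
    nonzero letter prescribed in the window of the first (a factor [O(1/m)])
    and forces all but two of the letters beyond that window to vanish (a
    geometric factor in the distance).  So the probability [b n] that there is
    no clump start satisfies [b (n + 1) = (1 - u) b n + o(u)] uniformly in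
    [n], whence [b n] is close to [exp (- n u)] as long as [n u] is bounded. *)

Set Implicit Arguments.
Unset Strict Implicit.
Unset Printing Implicit Defensive.

Import Order.TTheory GRing.Theory Num.Theory numFieldNormedType.Exports.

Local Open Scope classical_set_scope.
Local Open Scope ring_scope.

(** * Words of independent letters *)

Section WordMean.
Context (R : realType) (p q1 q2 : R).

Definition letter (v : R) : bool := v \in [:: 0; 1; -1].

Definition nonzeros (s : seq R) : nat := count (predC1 0) s.

(** Expectation of [f] at a word of [n] independent letters, as a finite recursion on the first
    letter, so that block events can be treated by induction without measure theory. *)
Fixpoint word_mean (n : nat) (f : seq R -> R) : R :=
  if n is n'.+1 then
    p * word_mean n' (fun s => f (0 :: s))
    + q1 * word_mean n' (fun s => f (1 :: s))
    + q2 * word_mean n' (fun s => f (-1 :: s))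
  else f [::].

Definition word_prob (n : nat) (Q : pred (seq R)) : R :=
  word_mean n (fun s => (Q s)%:R).

Lemma letter0 : letter 0. Proof. by rewrite /letter !inE eqxx. Qed.
Lemma letter1 : letter 1. Proof. by rewrite /letter !inE eqxx orbT. Qed.
Lemma letterN1 : letter (-1). Proof. by rewrite /letter !inE eqxx !orbT. Qed.

Lemma eq_word_mean n f g :
  (forall s, size s = n -> all letter s -> f s = g s) ->
  word_mean n f = word_mean n g.
Proof.
elim: n f g => [|n IHn] f g fg /=; first exact: fg.
by congr (_ * _ + _ * _ + _ * _); apply: IHn => s sn sl; apply: fg;
  rewrite /= ?sn ?letter0 ?letter1 ?letterN1.
Qed.

Lemma word_meanD n f g :
  word_mean n (fun s => f s + g s) = word_mean n f + word_mean n g.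
Proof. by elim: n f g => [|n IHn] f g //=; rewrite !IHn; ring. Qed.

Lemma word_meanZ n c f :
  word_mean n (fun s => c * f s) = c * word_mean n f.
Proof. by elim: n f => [|n IHn] f //=; rewrite !IHn; ring. Qed.

Lemma word_meanN n f : word_mean n (fun s => - f s) = - word_mean n f.
Proof.
rewrite -[RHS]mulN1r -word_meanZ.
by apply: eq_word_mean => s _ _; rewrite mulN1r.
Qed.

Lemma word_meanB n f g :
  word_mean n (fun s => f s - g s) = word_mean n f - word_mean n g.
Proof. by rewrite word_meanD word_meanN. Qed.

Lemma word_mean0 n : word_mean n (fun=> 0) = 0.
Proof. by elim: n => //= n ->; rewrite !mulr0 !addr0. Qed.

Lemma word_mean_sum n (I : Type) (r : seq I) (F : I -> seq R -> R) :
  word_mean n (fun s => \sum_(i <- r) F i s) = \sum_(i <- r) word_mean n (F i).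
Proof.
elim: r => [|i r IHr].
  rewrite big_nil -[RHS](word_mean0 n).
  by apply: eq_word_mean => s _ _; rewrite big_nil.
rewrite big_cons -IHr -word_meanD.
by apply: eq_word_mean => s _ _; rewrite big_cons.
Qed.

Lemma word_mean_cat a b f :
  word_mean (a + b) f
    = word_mean a (fun s => word_mean b (fun t => f (s ++ t))).
Proof. by elim: a f => [|a IHa] f //=; rewrite !IHa. Qed.

Lemma word_mean_indep a b f g :
  word_mean (a + b) (fun s => f (take a s) * g (drop a s))
    = word_mean a f * word_mean b g.
Proof.
rewrite word_mean_cat mulrC -word_meanZ; apply: eq_word_mean => s sa _.
rewrite mulrC -word_meanZ; apply: eq_word_mean => t _ _.
by rewrite take_size_cat // drop_size_cat.
Qed.

Hypotheses (p_gt0 : 0 < p) (q1_gt0 : 0 < q1) (q2_gt0 : 0 < q2).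
Hypothesis pq_sum : p + q1 + q2 = 1.

Lemma le_word_mean n f g :
  (forall s, size s = n -> all letter s -> f s <= g s) ->
  word_mean n f <= word_mean n g.
Proof.
elim: n f g => [|n IHn] f g fg /=; first exact: fg.
by rewrite !lerD // ler_pM2l //; apply: IHn => s sn sl; apply: fg;
  rewrite /= ?sn ?letter0 ?letter1 ?letterN1.
Qed.

Lemma word_mean_cst n c : word_mean n (fun=> c) = c.
Proof. by elim: n => //= n ->; rewrite -!mulrDl pq_sum mul1r. Qed.

Lemma word_mean_ge0 n f : (forall s, 0 <= f s) -> 0 <= word_mean n f.
Proof. by move=> f0; rewrite -(word_mean0 n); apply: le_word_mean. Qed.

Lemma word_mean_take a n f : (a <= n)%N ->
  word_mean n (fun s => f (take a s)) = word_mean a f.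
Proof.
move=> an; rewrite -[in LHS](subnKC an).
rewrite -[RHS]mulr1 -(word_mean_cst (n - a) 1) -word_mean_indep.
by apply: eq_word_mean => s _ _; rewrite mulr1.
Qed.

Lemma word_mean_drop a n f : (a <= n)%N ->
  word_mean n (fun s => f (drop a s)) = word_mean (n - a) f.
Proof.
move=> an; rewrite -[in LHS](subnKC an).
rewrite -[RHS]mul1r -(word_mean_cst a 1) -word_mean_indep.
by apply: eq_word_mean => s _ _; rewrite mul1r.
Qed.

Lemma word_mean_window k m n f : (k + m <= n)%N ->
  word_mean n (fun s => f (take m (drop k s))) = word_mean m f.
Proof.
move=> kmn; rewrite (word_mean_drop (fun s => f (take m s))).
  by rewrite word_mean_take // leq_subRL // (leq_trans (leq_addr _ _) kmn).
exact: leq_trans (leq_addr _ _) kmn.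
Qed.

(** * Words with prescribed numbers of nonzero letters *)

Definition has_type (a b : nat) (s : seq R) : bool :=
  [&& all letter s, count_mem 1 s == a & count_mem (-1) s == b].

(** With these ratios the probability of each type used below is a polynomial in [n] times [p ^+ n];
    the exponents [n - 1] and [n - 2], which truncate for small [n], do not appear. *)
Local Notation r1 := (q1 / p).
Local Notation r2 := (q2 / p).

Let N01 : (0 == 1 :> R) = false. Proof. by rewrite eq_sym oner_eq0. Qed.
Let N0N1 : (0 == -1 :> R) = false.
Proof. by rewrite eq_sym oppr_eq0 oner_eq0. Qed.
Let N1N1 : (1 == -1 :> R) = false.
Proof. by apply/negbTE/eqP; lra. Qed.
Let NN11 : (-1 == 1 :> R) = false.
Proof. by apply/negbTE/eqP; lra. Qed.

Definition letter_eqE := (letter0, letter1, letterN1, N01, N0N1, N1N1, NN11).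

Lemma has_type_cons0 a b s : has_type a b (0 :: s) = has_type a b s.
Proof. by rewrite /has_type /= !letter_eqE !add0n. Qed.

Lemma has_type_cons1 a b s :
  has_type a b (1 :: s) = (0 < a)%N && has_type a.-1 b s.
Proof.
rewrite /has_type /= !letter_eqE eqxx add0n add1n.
by case: a => [|a] //=; rewrite ?andbF // eqSS.
Qed.

Lemma has_type_consN1 a b s :
  has_type a b (-1 :: s) = (0 < b)%N && has_type a b.-1 s.
Proof.
rewrite /has_type /= !letter_eqE eqxx add0n add1n.
by case: b => [|b] //=; rewrite ?andbF // eqSS.
Qed.

(** The factors [(0 < a)%:R] and [(0 < b)%:R] discard the cases in which [a.-1] or [b.-1]
    truncates. *)
Lemma word_prob_typeS_and n a b (Q : pred (seq R)) :
  word_prob n.+1 (fun s => has_type a b s && Q s)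
    = p * word_prob n (fun s => has_type a b s && Q (0 :: s))
      + q1 * ((0 < a)%:R * word_prob n (fun s => has_type a.-1 b s && Q (1 :: s)))
      + q2 * ((0 < b)%:R * word_prob n (fun s => has_type a b.-1 s && Q (-1 :: s))).
Proof.
rewrite /word_prob -!word_meanZ /= -!word_meanZ.
congr (_ + _ + _); apply: eq_word_mean => s _ _.
- by rewrite has_type_cons0.
- by rewrite has_type_cons1 -andbA -mulnb natrM.
- by rewrite has_type_consN1 -andbA -mulnb natrM.
Qed.

Lemma word_prob_typeS n a b :
  word_prob n.+1 (has_type a b)
    = p * word_prob n (has_type a b)
      + q1 * ((0 < a)%:R * word_prob n (has_type a.-1 b))
      + q2 * ((0 < b)%:R * word_prob n (has_type a b.-1)).
Proof.
have E k c e :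
    word_prob k (has_type c e) = word_prob k (fun s => has_type c e s && true).
  by apply: eq_word_mean => s _ _; rewrite andbT.
by rewrite !E word_prob_typeS_and.
Qed.

Let p_neq0 : p != 0. Proof. by rewrite gt_eqF. Qed.

Lemma word_prob_type00 n : word_prob n (has_type 0 0) = p ^+ n.
Proof.
elim: n => [|n IHn]; first by rewrite expr0.
by rewrite word_prob_typeS /= IHn exprS; ring.
Qed.

Lemma word_prob_type10 n : word_prob n (has_type 1 0) = n%:R * r1 * p ^+ n.
Proof.
elim: n => [|n IHn]; first by rewrite !mul0r.
by rewrite word_prob_typeS /= IHn word_prob_type00 exprS -natr1; field.
Qed.

Lemma word_prob_type01 n : word_prob n (has_type 0 1) = n%:R * r2 * p ^+ n.
Proof.
elim: n => [|n IHn]; first by rewrite !mul0r.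
by rewrite word_prob_typeS /= IHn word_prob_type00 exprS -natr1; field.
Qed.

Lemma word_prob_type11 n :
  word_prob n (has_type 1 1) = n%:R * (n%:R - 1) * r1 * r2 * p ^+ n.
Proof.
elim: n => [|n IHn]; first by rewrite !mul0r.
rewrite word_prob_typeS /= IHn word_prob_type01 word_prob_type10 exprS -natr1.
by field.
Qed.

(* The law of the letters is exchangeable, so a nonzero letter at position [k]
   may as well be the first letter. *)
Lemma word_prob_type_nth n k a b : (k <= n)%N ->
  word_prob n.+1 (fun s => has_type a b s && (nth 0 s k != 0))
    = q1 * ((0 < a)%:R * word_prob n (has_type a.-1 b))
      + q2 * ((0 < b)%:R * word_prob n (has_type a b.-1)).
Proof.
elim: k n a b => [|k IHk] n a b; last first.
  case: n => [//|n] kn; rewrite word_prob_typeS_and /= !IHk //.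
  by rewrite !word_prob_typeS; ring.
move=> _; rewrite word_prob_typeS_and /= eqxx oppr_eq0 oner_eq0 /=.
have E c e :
    word_prob n (fun s => has_type c e s && true) = word_prob n (has_type c e).
  by apply: eq_word_mean => s _ _; rewrite andbT.
rewrite !E [X in p * X](_ : _ = 0) ?mulr0 ?add0r //.
by rewrite -[RHS](word_mean0 n); apply: eq_word_mean => s _ _; rewrite andbF.
Qed.

Lemma word_mean_prod n (g : R -> R) :
  word_mean n (fun s => \prod_(v <- s) g v)
    = (p * g 0 + q1 * g 1 + q2 * g (-1)) ^+ n.
Proof.
elim: n => [|n IHn]; first by rewrite /= big_nil.
rewrite exprS -IHn /= !mulrDl -!mulrA -!word_meanZ.
by congr (_ + _ + _); apply: eq_word_mean => s _ _; rewrite big_cons.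
Qed.

(* Chernoff bound with weight [1/2] for each nonzero letter. *)
Lemma word_prob_few_nonzero n :
  word_prob n (fun s => (nonzeros s <= 2)%N)
    <= 4 * ((1 + p) / 2) ^+ n.
Proof.
have -> : ((1 + p) / 2) ^+ n
    = word_mean n (fun s => \prod_(v <- s) (if v == 0 then 1 else 2^-1)).
  rewrite word_mean_prod eqxx oppr_eq0 oner_eq0 /=.
  have -> : q2 = 1 - p - q1 by move: pq_sum => E; lra.
  by congr (_ ^+ n); field.
rewrite -word_meanZ; apply: le_word_mean => s _ _.
have -> : \prod_(v <- s) (if v == 0 then 1 else 2^-1)
    = 2^-1 ^+ nonzeros s :> R.
  elim: s => [|v s IHs]; first by rewrite big_nil.
  by rewrite big_cons IHs /nonzeros /=; case: eqP => _; rewrite ?mul1r // exprD.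
(* At most two nonzero letters leave a weight of at least [1 / 4], whence the factor 4. *)
case: leqP => [c2|_]; last first.
  by rewrite mulr_ge0 ?exprn_ge0 ?invr_ge0 ?ler0n.
have -> : 1%:R = 4 * 2^-1 ^+ 2 :> R by rewrite expr2; field.
by rewrite ler_pM2l ?ltr0n // ler_wiXn2l // ?invr_ge0 ?ler0n //; lra.
Qed.

(** * Clump starts *)

Section Clumps.
Variable m : nat.

Definition clump_start (s : seq R) : bool :=
  (head 0 s != 0) && has_type 1 1 (take m (behead s)).

Definition clump_free (n : nat) (s : seq R) : bool :=
  all (fun i => ~~ clump_start (drop i s)) (iota 0 n).

Let u := word_prob m.+1 clump_start.
(** The length [n + m] is the least for which the windows of all [n] positions are complete;
    [take m] would silently shorten a window at the end of the word. *)
Let b n := word_prob (n + m) (clump_free n).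

Lemma word_prob_clump_start :
  u = (1 - p) * (m%:R * (m%:R - 1) * r1 * r2 * p ^+ m).
Proof.
rewrite /u /word_prob /clump_start /= eqxx oner_eq0 oppr_eq0 oner_eq0 /=.
rewrite word_mean0 mulr0 add0r.
have -> : word_mean m (fun s => (has_type 1 1 (take m s))%:R)
    = word_prob m (has_type 1 1).
  by apply: eq_word_mean => s sm _; rewrite take_oversize ?sm.
by rewrite word_prob_type11 -mulrDl; congr (_ * _); move: pq_sum => E; lra.
Qed.

Lemma word_prob_ge0 n Q : 0 <= word_prob n Q.
Proof. by apply: word_mean_ge0 => s; rewrite ler0n. Qed.

Lemma word_prob_le1 n Q : word_prob n Q <= 1.
Proof.
by rewrite -(word_mean_cst n 1); apply: le_word_mean => s _ _; rewrite lern1 leq_b1.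
Qed.

Lemma clump_start_take s : clump_start (take m.+1 s) = clump_start s.
Proof. by case: s => [//|v s]; rewrite /clump_start /= take_taker. Qed.

Lemma clump_freeS n s :
  clump_free n.+1 s = ~~ clump_start s && clump_free n (behead s).
Proof.
rewrite /clump_free /= drop0; congr (_ && _).
rewrite -(addn0 1%N) iotaDl all_map; apply: eq_all => i /=.
by rewrite -drop1 drop_drop addn1.
Qed.

Lemma clump_free_drop n k s : clump_free n s -> clump_free (n - k) (drop k s).
Proof.
move=> /allP ns; apply/allP => i; rewrite mem_iota add0n => /= ink.
by rewrite drop_drop; apply: ns; rewrite mem_iota /= add0n addnC -ltn_subRL.
Qed.

Lemma word_prob_clump_start_prefix n : (m < n)%N -> word_prob n clump_start = u.
Proof.
move=> mn; rewrite /u /word_prob.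
rewrite -(word_mean_take (fun s => (clump_start s)%:R) mn).
by apply: eq_word_mean => s _ _; rewrite clump_start_take.
Qed.

Lemma clump_free_mean_behead n :
  word_prob (n.+1 + m) (fun s => clump_free n (behead s)) = b n.
Proof.
have e : (n.+1 + m - 1 = n + m)%N by rewrite addSn subn1.
rewrite /b /word_prob -e -(word_mean_drop (fun s => (clump_free n s)%:R)) //.
by apply: eq_word_mean => s _ _; rewrite drop1.
Qed.

Let J n := word_prob (n.+1 + m)
  (fun s => clump_start s && clump_free n (behead s)).

(** Deleting the first letter does not change the law of the rest, so [b n] is also the probability
    that the last [n] of [n.+1] positions are free; [J n] is the part where the first one is not. *)
Lemma clump_free_step n : b n.+1 = b n - J n.
Proof.
rewrite -(clump_free_mean_behead n) /b /J /word_prob -word_meanB.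
apply: eq_word_mean => s _ _; rewrite clump_freeS.
by case: (clump_start s); case: clump_free; rewrite /= ?subr0 ?subrr.
Qed.

Lemma clump_free_lower n k : b n - k%:R * u <= b (n + k)%N.
Proof.
elim: k => [|k IHk]; first by rewrite mul0r subr0 addn0.
rewrite addnS clump_free_step -natr1.
suff : J (n + k)%N <= u by lra.
rewrite -(@word_prob_clump_start_prefix ((n + k).+1 + m)) ?addSn ?ltnS ?leq_addl //.
rewrite /J /word_prob addSn.
apply: le_word_mean => s _ _; rewrite ler_nat.
by case: clump_start; rewrite //= leq_b1.
Qed.

(** This is [b (n - m)] if [m <= n] and 1 otherwise: the factor contributed by the positions beyond
    the window of a clump start. *)
Let c n := word_prob n (clump_free (n - m)).

Lemma clump_free_skip n : b n <= c n <= b n + m%:R * u.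
Proof.
apply/andP; split.
  have := word_mean_drop (fun s => (clump_free (n - m) s)%:R) (leq_addl n m).
  rewrite addnK /c /word_prob => <-; apply: le_word_mean => s _ _.
  by rewrite ler_nat; have := @clump_free_drop n m s; case: clump_free => // ->.
have [mn|/ltnW nm] := leqP m n.
  have := clump_free_lower (n - m) m.
  by rewrite {1}/b /c subnK //; lra.
(* Here [n < m], so the subtraction in [c n] truncates and [c n] is 1; [b n] is compared with [b 0],
   which is 1 as well. *)
have u0 : 0 <= u by exact: word_prob_ge0.
have := clump_free_lower 0 n; rewrite add0n.
have -> : b 0 = 1 by rewrite /b /word_prob word_mean_cst.
have -> : c n = 1.
  rewrite /c /word_prob; move: nm; rewrite -subn_eq0 => /eqP ->.
  by rewrite word_mean_cst.
have : n%:R * u <= m%:R * u by rewrite ler_wpM2r // ler_nat.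
lra.
Qed.

(** The first event depends on the first [m.+1] letters, the second one on the other [n], so they
    are independent. *)
Lemma clump_start_skip n :
  word_prob (n.+1 + m) (fun s => clump_start s && clump_free (n - m) (drop m.+1 s))
    = u * c n.
Proof.
rewrite addSnnS addnC /u /c /word_prob -word_mean_indep.
apply: eq_word_mean => s _ _.
by rewrite clump_start_take -mulnb natrM.
Qed.

(** * Overlapping clump starts *)

Lemma has_type_nonzeros a b' s : has_type a b' s -> (nonzeros s <= a + b')%N.
Proof.
case/and3P=> sl /eqP <- /eqP <-; elim: s sl => //= v s IHs /andP[vl sl].
have vE : ((v != 0%R) <= (v == 1%R) + (v == (-1)%R))%N.
  by move: vl; rewrite /letter !inE; case: eqP => //= _; case: eqP => //= _ ->.
apply: leq_trans (leq_add vE (IHs sl)) _.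
by rewrite addnACA.
Qed.

(** The second clump start sits on a letter of the first window, and its own window covers the
    [i.+1] letters that follow the first window. The conditions obtained concern disjoint blocks of
    letters. *)
Lemma clump_start_overlap s i : (i < m)%N ->
  clump_start s && clump_start (drop i.+1 s) ->
  (clump_start (take m.+1 s) && (nth 0 (take m.+1 s) i.+1 != 0))
    && (nonzeros (take i.+1 (drop m.+1 s)) <= 2)%N.
Proof.
move=> im /andP[s0 /andP[si di]]; rewrite clump_start_take s0 nth_take //=.
rewrite -nth0 nth_drop addn0 in si; rewrite si /=.
apply: leq_trans (has_type_nonzeros di).
rewrite -drop1 drop_drop add1n.
have -> : take i.+1 (drop m.+1 s) = drop (m - i.+1) (take m (drop i.+2 s)).
  transitivity (drop (m - i.+1) (take (i.+1 + (m - i.+1)) (drop i.+2 s))).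
    by rewrite -take_drop drop_drop addnS subnK.
  by rewrite subnKC.
by rewrite -{2}(cat_take_drop (m - i.+1) (take m _)) /nonzeros count_cat leq_addl.
Qed.

(** By independence a product bounds the probability. The first factor is [2 / m] times that of a
    clump start: by exchangeability every position of the window is equally likely to carry one of
    its two nonzero letters. The second factor is the Chernoff bound. *)
Lemma clump_start_overlap_prob n i : (i < m)%N -> (i < n)%N ->
  word_prob (n.+1 + m) (fun s => clump_start s && clump_start (drop i.+1 s))
    <= (1 - p) * (2 * (m%:R - 1) * r1 * r2 * p ^+ m)
         * (4 * ((1 + p) / 2) ^+ i.+1).
Proof.
move=> im ni.
pose g s := clump_start s && (nth 0 s i.+1 != 0).
pose h s := (nonzeros (take i.+1 s) <= 2)%N.
have gE : word_prob m.+1 g = (1 - p) * (2 * (m%:R - 1) * r1 * r2 * p ^+ m).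
  rewrite /word_prob /g /clump_start /= eqxx oner_eq0 oppr_eq0 oner_eq0 /=.
  rewrite word_mean0 mulr0 add0r -mulrDl.
  have -> : q1 + q2 = 1 - p by move: pq_sum => E; lra.
  congr (_ * _).
  transitivity (word_prob m (fun s => has_type 1 1 s && (nth 0 s i != 0))).
    by apply: eq_word_mean => s sm _; rewrite take_oversize ?sm.
  rewrite -(ltn_predK im) word_prob_type_nth; last by rewrite -ltnS (ltn_predK im).
  rewrite /= word_prob_type10 word_prob_type01 exprS.
  rewrite -[X in _ = 2 * (X - 1) * _ * _ * _]natr1.
  by field.
have hE : word_prob n h <= 4 * ((1 + p) / 2) ^+ i.+1.
  apply: le_trans (word_prob_few_nonzero i.+1).
  by rewrite /word_prob -(word_mean_take (fun s => (nonzeros s <= 2)%N%:R) ni).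
apply: le_trans (_ : word_prob m.+1 g * word_prob n h <= _); last first.
  by rewrite gE; apply: ler_wpM2l => //; rewrite -gE word_prob_ge0.
rewrite /word_prob -word_mean_indep addSnnS addnC.
apply: le_word_mean => s _ _; rewrite -natrM mulnb ler_nat.
by have := @clump_start_overlap s i im; case: andb => // /(_ isT) ->.
Qed.

Lemma sum_geometric_le (x : R) n : 0 <= x < 1 ->
  \sum_(i <- iota 0 n) x ^+ i <= (1 - x)^-1.
Proof.
move=> /andP[x0 x1]; rewrite -[X in iota 0 X]subn0 big_mkord.
have x1' : 0 < 1 - x by rewrite subr_gt0.
rewrite -(ler_pM2l x1') divff ?gt_eqF // -opprB mulNr -subrX1 opprB.
by rewrite gerBl exprn_ge0.
Qed.

(** The constant is [2 * 4 * 2]: two nonzero letters, the Chernoff constant, and the sum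
    [2 / (1 - p)] of the geometric series of ratio [(1 + p) / 2], whose denominator cancels the
    factor [1 - p]. The factor [m - 1] is rounded up to [m]. *)
Let delta := 16 * m%:R * r1 * r2 * p ^+ m.

Lemma clump_start_overlaps_prob n :
  \sum_(i <- iota 0 (minn m n)) word_prob (n.+1 + m)
      (fun s => clump_start s && clump_start (drop i.+1 s)) <= delta.
Proof.
have q_gt0 : 0 < 1 - p.
  by have := pq_sum; have := q1_gt0; have := q2_gt0; lra.
have rr : 0 <= r1 * r2 * p ^+ m.
  by rewrite !mulr_ge0 ?exprn_ge0 ?invr_ge0 // ltW.
pose D := (1 - p) * (2 * m%:R * (r1 * r2 * p ^+ m)).
have D0 : 0 <= D.
  by apply: mulr_ge0; [exact: ltW|apply: mulr_ge0 => //; apply: mulr_ge0].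
pose rho := (1 + p) / 2.
have rho01 : 0 <= rho < 1 by rewrite /rho; have := p_gt0; lra.
have /andP[rho0 /ltW rho1] := rho01.
apply: (@le_trans _ _ (\sum_(i <- iota 0 (minn m n)) D * 4 * rho ^+ i)).
  rewrite big_seq [leRHS]big_seq; apply: ler_sum => i.
  rewrite mem_iota add0n leq_min => /= /andP[im iN].
  apply: le_trans (clump_start_overlap_prob im iN) _.
  have m1 : 0 <= m%:R - 1 :> R by rewrite subr_ge0 ler1n (leq_ltn_trans _ im).
  rewrite -[leRHS]mulrA; apply: ler_pM.
  - apply: mulr_ge0; first exact: ltW.
    by rewrite !mulr_ge0 // ?exprn_ge0 ?invr_ge0 // ltW.
  - by rewrite mulr_ge0 // exprn_ge0.
  - rewrite /D ler_pM2l // -subr_ge0.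
    have -> : 2 * m%:R * (r1 * r2 * p ^+ m) - 2 * (m%:R - 1) * r1 * r2 * p ^+ m
        = 2 * (r1 * r2 * p ^+ m) by ring.
    by rewrite mulr_ge0.
  - by rewrite ler_pM2l // exprS ler_piMl // exprn_ge0.
rewrite -mulr_sumr.
apply: le_trans (ler_wpM2l _ (sum_geometric_le _ rho01)) _.
  by rewrite mulr_ge0.
rewrite le_eqVlt; apply/orP; left; apply/eqP; rewrite /rho /delta /D.
have -> : 1 - (1 + p) / 2 = (1 - p) / 2 by field.
by field; rewrite !gt_eqF.
Qed.

(** Union bound: if a clump start is followed by another one, but by none beyond its window, then
    the other one overlaps it. *)
Lemma clump_free_meet_ge n :
  u * c n - \sum_(i <- iota 0 (minn m n)) word_prob (n.+1 + m)
      (fun s => clump_start s && clump_start (drop i.+1 s)) <= J n.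
Proof.
rewrite -clump_start_skip -word_mean_sum /word_prob -word_meanB /J /word_prob.
apply: le_word_mean => s _ _.
rewrite lerBlDr.
have ge0 (I : seq nat) (F : nat -> bool) : 0 <= \sum_(i <- I) (F i)%:R :> R.
  by apply: sumr_ge0 => i _; rewrite ler0n.
case: (boolP (clump_free (n - m) _)) => [nm|_]; last first.
  by rewrite andbF addr_ge0 ?ler0n ?ge0.
case: (boolP (clump_start s)) => [s0|_]; last first.
  by rewrite /= add0r (ge0 _ (fun=> false)).
case: (boolP (clump_free n _)) => [_|]; first by rewrite lerDl ge0.
move=> /allPn[i]; rewrite mem_iota add0n => /= ni; rewrite negbK => si.
rewrite add0r.
have im : (i < m)%N.
  rewrite ltnNge; apply/negP => mi; move/allP: nm => /(_ (i - m)%N).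
  rewrite mem_iota add0n ltn_sub2rE // ni drop_drop => /(_ isT).
  by rewrite addnS subnK // -addn1 -drop_drop drop1 si.
rewrite (big_rem i) /=; last by rewrite mem_iota add0n leq_min im.
have -> : drop i.+1 s = drop i (behead s) by rewrite -drop1 drop_drop addn1.
by rewrite si lerDl ge0.
Qed.

(** The quantity to bound is [u * b n - J n]. Replacing [b n] by [c n] costs at most [m * u] times
    [u], and [u * c n] exceeds [J n] by at most the overlaps, [delta]. *)
Lemma clump_free_recursion n :
  `|b n.+1 - (1 - u) * b n| <= m%:R * u ^+ 2 + delta.
Proof.
have u0 : 0 <= u by exact: word_prob_ge0.
have /andP[bc cb] := clump_free_skip n.
have lo := clump_free_meet_ge n; have ov := clump_start_overlaps_prob n.
have hi : J n <= u * c n.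
  rewrite -clump_start_skip; apply: le_word_mean => s _ _.
  rewrite ler_nat; case: (clump_start s) => //=.
  have := @clump_free_drop n m (behead s); rewrite -drop1 drop_drop addn1.
  by case: (clump_free n _) => // ->.
have ubc : u * b n <= u * c n by rewrite ler_wpM2l.
have ucb : u * c n <= u * (b n + m%:R * u) by rewrite ler_wpM2l.
have d0 : 0 <= delta.
  by apply: le_trans ov; apply: sumr_ge0 => i _; apply: word_prob_ge0.
have mu : 0 <= m%:R * u ^+ 2 by rewrite mulr_ge0 ?exprn_ge0.
rewrite clump_free_step ler_norml; apply/andP; split; lra.
Qed.

(** * Comparison of runs with clump starts *)

Definition sparse (s : seq R) : bool :=
  [|| has_type 0 0 s, has_type 1 0 s | has_type 0 1 s].

Lemma contaminated_runE s :
  contaminated_run s = sparse s || has_type 1 1 s.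
Proof.
rewrite /contaminated_run /sparse /has_type /letter.
case: (all _ s); last by rewrite !andbF.
by case: (count_mem 1 s) => [|[|?]]; case: (count_mem (-1) s) => [|[|?]].
Qed.

Lemma contaminated_run_cons0 k (s : seq R) :
  contaminated_run s -> contaminated_run (0 :: take k s).
Proof.
rewrite /contaminated_run /= !letter_eqE !add0n inE eqxx /=.
rewrite -{1 2 3}(cat_take_drop k s) !count_cat all_cat => /and3P[c1 c2 /andP[-> _]].
by rewrite (leq_trans (leq_addr _ _) c1) (leq_trans (leq_addr _ _) c2).
Qed.

Definition run_free (n : nat) (s : seq R) : bool :=
  all (fun k => ~~ contaminated_run (take m (drop k s))) (iota 0 n).

(** The window of a clump start at [i] is a run starting at [i.+1], whence the shift by one. *)
Lemma run_free_clump_free n s : run_free n.+1 s -> clump_free n s.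
Proof.
move=> /allP rf; apply/allP => i; rewrite mem_iota add0n => /= ni.
have := rf i.+1; rewrite mem_iota /= add0n ltnS => /(_ ni).
apply: contraNN => /andP[_]; rewrite -drop1 drop_drop add1n => t11.
by rewrite contaminated_runE t11 orbT.
Qed.

(* Moving a run to the left over a success yields a run again, unless it
   already is the window of a clump start or too sparse. *)
Lemma contaminated_run_clump_free n k s : (0 < m)%N -> (k <= n)%N ->
  clump_free n s -> contaminated_run (take m (drop k s)) ->
  contaminated_run (take m s) \/
  exists2 j, (j <= n)%N & sparse (take m (drop j s)).
Proof.
move=> m0 + cf; elim: k => [|k IHk] kn run; first by left; rewrite drop0 in run.
move: (run); rewrite contaminated_runE => /orP[sp|t11]; first by right; exists k.+1.
apply: IHk; first exact: ltnW.
(* Position [k] is no clump start although the window after it has one [1] and one [-1]; hence its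
   letter is 0 and the window starting at [k] is a run. *)
move/allP: cf => /(_ k); rewrite mem_iota add0n => /(_ kn).
rewrite /clump_start -drop1 drop_drop add1n t11 andbT negbK.
move: run; rewrite -add1n -drop_drop drop1.
case: (drop k s) => [|v t] /=; first by [].
move=> run /eqP ->; rewrite -(ltn_predK m0) /=.
by have := contaminated_run_cons0 m.-1 run; rewrite take_takel // leq_pred.
Qed.

Lemma run_free_prob_le n : word_prob (n + m) (run_free n.+1) <= b n.
Proof.
apply: le_word_mean => s _ _; rewrite ler_nat.
by have := @run_free_clump_free n s; case: run_free => // ->.
Qed.

(** A word with a run but no clump start begins with a run or has a sparse window; the union bound
    over these events gives the two corrections. *)
Lemma run_free_prob_ge n : (0 < m)%N ->
  b n - word_prob m (@contaminated_run R) - n.+1%:R * word_prob m sparse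
    <= word_prob (n + m) (run_free n.+1).
Proof.
move=> m0.
have -> : n.+1%:R * word_prob m sparse = word_mean (n + m)
    (fun s => \sum_(k <- iota 0 n.+1) (sparse (take m (drop k s)))%:R).
  rewrite word_mean_sum (eq_big_seq (fun=> word_prob m sparse)); last first.
    move=> k; rewrite mem_iota add0n ltnS => /= kn.
    by rewrite (word_mean_window (fun s => (sparse s)%:R)) // leq_add2r.
  by rewrite big_const_seq count_predT size_iota iter_addr addr0 mulr_natl.
have -> : word_prob m (@contaminated_run R)
    = word_mean (n + m) (fun s => (contaminated_run (take m s))%:R).
  by rewrite (word_mean_take (fun s => (contaminated_run s)%:R)) // leq_addl.
rewrite /b /word_prob -!word_meanB; apply: le_word_mean => s _ _.
rewrite !lerBlDr.
have ge0 (F : nat -> bool) : 0 <= \sum_(k <- iota 0 n.+1) (F k)%:R :> R.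
  by apply: sumr_ge0 => i _; rewrite ler0n.
case: (boolP (clump_free n s)) => [cf|_]; last by rewrite !addr_ge0 ?ler0n ?ge0.
case: (boolP (run_free n.+1 s)) => [_|].
  by rewrite -addrA lerDl addr_ge0 ?ler0n ?ge0.
move=> /allPn[k]; rewrite mem_iota add0n ltnS negbK => /= kn.
move=> /(contaminated_run_clump_free m0 kn cf)[->|[j jn sp]].
  by rewrite lerDr addr_ge0 ?ler0n ?ge0.
rewrite (big_rem j); last first.
  by rewrite -[_ :: _]/(iota 0 n.+1) mem_iota add0n ltnS.
rewrite sp.
rewrite addrCA -addrA lerDl !addr_ge0 ?ler0n //.
by apply: sumr_ge0 => i _; rewrite ler0n.
Qed.

Lemma sparse_prob : word_prob m sparse <= (1 + m%:R * (r1 + r2)) * p ^+ m.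
Proof.
have -> : (1 + m%:R * (r1 + r2)) * p ^+ m = word_prob m (has_type 0 0)
    + word_prob m (has_type 1 0) + word_prob m (has_type 0 1).
  by rewrite word_prob_type00 word_prob_type10 word_prob_type01; ring.
rewrite /word_prob -!word_meanD; apply: le_word_mean => s _ _.
rewrite -!natrD ler_nat /sparse.
by do 3 case: has_type.
Qed.

Lemma contaminated_run_prob_bounds :
  word_prob m (has_type 1 1) <= word_prob m (@contaminated_run R)
    <= word_prob m (has_type 1 1) + word_prob m sparse.
Proof.
apply/andP; split; last rewrite /word_prob -word_meanD.
all: apply: le_word_mean => s _ _; rewrite -?natrD ler_nat contaminated_runE.
all: by case: sparse; case: has_type.
Qed.

End Clumps.
End WordMean.

(** * From trials to words *)

Section Trials.
Context (R : realType) (d : measure_display) (T : measurableType d).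
Context (P : probability T R) (p q1 q2 : R) (X : nat -> {RV P >-> R}).
Hypotheses (p_gt0 : 0 < p) (q1_gt0 : 0 < q1) (q2_gt0 : 0 < q2).
Hypothesis pq_sum : p + q1 + q2 = 1.
Hypothesis X_indep : mutually_independent X.
Hypothesis X_0 : forall i, P (X i @^-1` [set 0]) = p%:E.
Hypothesis X_p1 : forall i, P (X i @^-1` [set 1]) = q1%:E.
Hypothesis X_m1 : forall i, P (X i @^-1` [set -1]) = q2%:E.

Lemma blockS k n w : block X k n.+1 w = X k w :: block X k.+1 n w.
Proof. by []. Qed.

Lemma size_block k n w : size (block X k n w) = n.
Proof. by rewrite size_map size_iota. Qed.

Lemma block_window k m n w : (k + m <= n)%N ->
  take m (drop k (block X 0 n w)) = block X k m w.
Proof.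
move=> kmn; rewrite /block -map_drop -map_take drop_iota take_iota add0n.
congr map; congr iota; apply/minn_idPl.
by rewrite leq_subRL // (leq_trans (leq_addr _ _) kmn).
Qed.

Lemma measurable_trial i (v : R) : measurable (X i @^-1` [set v]).
Proof. exact: measurable_funPTI. Qed.

(** Restricting the outcomes to the three letters makes this a finite union of cylinders, hence
    measurable for arbitrary [Q]; it removes only a null set. *)
Let good (Q : pred (seq R)) k n : set T :=
  [set w | all (@letter R) (block X k n w) && Q (block X k n w)].

Lemma good_split Q k n : good Q k n.+1 =
  (X k @^-1` [set 0] `&` good (fun s => Q (0 :: s)) k.+1 n)
  `|` (X k @^-1` [set 1] `&` good (fun s => Q (1 :: s)) k.+1 n)
  `|` (X k @^-1` [set -1] `&` good (fun s => Q (-1 :: s)) k.+1 n).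
Proof.
apply/seteqP; split=> w; rewrite /good /= blockS /=.
  move=> /andP[/andP[Xl ->]] /=; move: Xl; rewrite /letter !inE.
  by case/or3P => /eqP -> ?; [left; left|left; right|right].
by case=> [[]|] [-> /andP[-> ->]]; rewrite ?letter0 ?letter1 ?letterN1.
Qed.

Lemma measurable_good Q k n : measurable (good Q k n).
Proof.
elim: n k Q => [|n IHn] k Q.
  rewrite /good /=; case: (Q [::]).
    by rewrite [X in measurable X](_ : _ = setT) //; apply/seteqP; split.
  by rewrite [X in measurable X](_ : _ = set0) //; apply/seteqP; split.
rewrite good_split; apply: measurableU; first apply: measurableU.
all: by apply: measurableI => //; exact: measurable_trial.
Qed.

Lemma measurable_cylinder k u :
  measurable [set w | block X k (size u) w = u].
Proof.
elim: u k => [|v u IHu] k.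
  by rewrite [X in measurable X](_ : _ = setT) //; apply/seteqP; split.
have -> : [set w | block X k (size (v :: u)) w = v :: u]
    = X k @^-1` [set v] `&` [set w | block X k.+1 (size u) w = u].
  by apply/seteqP; split=> w /=; rewrite blockS => -[-> ->].
by apply: measurableI; [exact: measurable_trial|exact: IHu].
Qed.

Definition letter_prob (v : R) : R :=
  if v == 0 then p else if v == 1 then q1 else q2.

Lemma trial_prob i v : letter v -> P (X i @^-1` [set v]) = (letter_prob v)%:E.
Proof.
rewrite /letter !inE /letter_prob => /or3P[] /eqP ->.
- by rewrite eqxx X_0.
- by rewrite oner_eq0 eqxx X_p1.
- by rewrite oppr_eq0 oner_eq0 (letter_eqE R) X_m1.
Qed.

Lemma cylinder_prob u : all (@letter R) u ->
  P [set w | block X 0 (size u) w = u] = (\prod_(v <- u) letter_prob v)%:E.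
Proof.
move=> ul.
have -> : [set w | block X 0 (size u) w = u]
    = \bigcap_(i in [set` iota 0 (size u)]) X i @^-1` [set nth 0 u i].
  apply/seteqP; split=> w /=.
    move=> e i /=; rewrite mem_iota add0n => /= iu.
    by rewrite -e (nth_map 0%N) ?size_iota // nth_iota.
  move=> e; apply: (@eq_from_nth _ 0); first by rewrite size_block.
  rewrite size_block => i iu; rewrite (nth_map 0%N) ?size_iota // nth_iota //.
  by apply: e; rewrite /= mem_iota.
rewrite (X_indep (iota_uniq _ _)) => [|i]; last exact: measurable_set1.
rewrite -prodEFin [RHS](big_nth 0) /index_iota subn0 big_seq [RHS]big_seq.
apply: eq_bigr => i; rewrite mem_iota add0n => /= iu.
by rewrite trial_prob // (allP ul) // mem_nth.
Qed.

(** The prefix [u] is there for the induction on [n]: each step moves one more letter into [u],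
    until a plain cylinder remains, to which mutual independence applies. *)
Lemma cylinder_good_prob u n Q : all (@letter R) u ->
  P ([set w | block X 0 (size u) w = u] `&` good Q (size u) n)
    = ((\prod_(v <- u) letter_prob v) * word_prob p q1 q2 n Q)%:E.
Proof.
elim: n u Q => [|n IHn] u Q ul.
  rewrite /good /= /word_prob /=; case: (Q [::]).
    rewrite mulr1 -cylinder_prob //; congr (P _).
    by apply/seteqP; split=> w //= [].
  rewrite mulr0 (_ : _ `&` _ = set0) ?measure0 //.
  by apply/seteqP; split=> w //= [].
pose C v := [set w | block X 0 (size (rcons u v)) w = rcons u v]
  `&` good (fun s => Q (v :: s)) (size (rcons u v)) n.
have CE v : C v = [set w | block X 0 (size u) w = u]
    `&` (X (size u) @^-1` [set v] `&` good (fun s => Q (v :: s)) (size u).+1 n).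
  have bE w : block X 0 (size u).+1 w = rcons (block X 0 (size u) w) (X (size u) w).
    by rewrite /block -addn1 iotaD map_cat add0n cats1.
  rewrite /C size_rcons; apply/seteqP; split=> w /=; rewrite bE.
    by case=> /rcons_inj[-> ->].
  by case=> -> [-> ].
have Cm v : measurable (C v).
  by apply: measurableI; [exact: measurable_cylinder|exact: measurable_good].
have -> : [set w | block X 0 (size u) w = u] `&` good Q (size u) n.+1
    = C 0 `|` C 1 `|` C (-1).
  by rewrite good_split !setIUr !CE.
have Cd v v' : v != v' -> C v `&` C v' = set0.
  move=> /eqP vv'; apply/seteqP; split=> w //=; rewrite !CE.
  by move=> [[_ [e _]] [_ [e' _]]]; apply: vv'; rewrite -e -e'.
have CP v : letter v -> P (C v) = ((\prod_(v <- u) letter_prob v) * letter_prob v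
    * word_prob p q1 q2 n (fun s => Q (v :: s)))%:E.
  move=> vl; rewrite IHn ?all_rcons ?vl //.
  by rewrite -cats1 big_cat big_seq1.
have -> : P (C 0 `|` C 1 `|` C (-1)) = (P (C 0%R) + P (C 1%R) + P (C (-1)%R))%E.
  rewrite measureU //; first rewrite measureU //.
  - by apply: Cd; rewrite eq_sym oner_eq0.
  - exact: measurableU.
  - by rewrite setIUl !Cd ?setU0 ?(letter_eqE R).
rewrite !CP ?letter0 ?letter1 ?letterN1 // -!EFinD /letter_prob.
rewrite !eqxx !oppr_eq0 !oner_eq0 !(letter_eqE R) /word_prob /=.
by congr EFin; ring.
Qed.

Lemma block_prob n Q :
  P [set w | all (@letter R) (block X 0 n w) && Q (block X 0 n w)]
    = (word_prob p q1 q2 n Q)%:E.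
Proof.
have := cylinder_good_prob n Q (isT : all (@letter R) [::]).
rewrite big_nil mul1r => <-; congr (P _).
by apply/seteqP; split=> w //= [].
Qed.

Lemma block_letters n :
  P [set w | all (@letter R) (block X 0 n w)] = 1%E.
Proof.
have := block_prob n (fun=> true).
rewrite /word_prob word_mean_cst // => <-; congr (P _).
by apply/seteqP; split=> w /=; rewrite andbT.
Qed.

Lemma block_letters_prob n (Q : pred (seq R)) :
  measurable [set w | Q (block X 0 n w)] ->
  P [set w | Q (block X 0 n w)] = (word_prob p q1 q2 n Q)%:E.
Proof.
move=> mQ; pose G := [set w | all (@letter R) (block X 0 n w)].
have GE : G = good (fun=> true) 0 n.
  by apply/seteqP; split=> w; rewrite /G /good /= andbT.
have mG : measurable G by rewrite GE; exact: measurable_good.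
have -> : P [set w | Q (block X 0 n w)] = (P ([set w | Q (block X 0 n w)] `\` G)
    + P ([set w | Q (block X 0 n w)] `&` G))%E by exact: measureDI.
rewrite -block_prob.
have -> : P ([set w | Q (block X 0 n w)] `\` G) = 0%E.
  apply/eqP; rewrite eq_le measure_ge0 andbT.
  have -> : 0%E = P (~` G) :> \bar R.
    by rewrite probability_setC // block_letters subee.
  apply: le_measure; rewrite ?inE //; first exact: measurableD.
    exact: measurableC.
rewrite add0e; congr (P _).
by apply/seteqP; split=> w /=; rewrite /G /=; [case=> -> ->|case/andP].
Qed.

(** * Run events and the hitting time *)

Lemma measurable_contaminated_run k m :
  measurable [set w | contaminated_run (block X k m w)].
Proof.
have -> : [set w | contaminated_run (block X k m w)]
    = good (@contaminated_run R) k m.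
  apply/seteqP; split=> w; rewrite /good /=; last by case/andP.
  by move=> run; rewrite run andbT; case/and3P: run.
exact: measurable_good.
Qed.

Lemma event_A1_prob m :
  P (event_A1 X m) = (word_prob p q1 q2 m (@contaminated_run R))%:E.
Proof. exact: block_letters_prob (measurable_contaminated_run 0 m). Qed.

Lemma measurable_run_free m n N : (n.-1 + m <= N)%N ->
  measurable [set w | run_free m n (block X 0 N w)].
Proof.
rewrite /run_free; elim: n => [|n IHn] nm.
  by rewrite [X in measurable X](_ : _ = setT) //; apply/seteqP; split.
rewrite -addn1 iotaD.
have -> : [set w | all (fun k => ~~ contaminated_run
      (take m (drop k (block X 0 N w)))) (iota 0 n ++ iota (0 + n) 1)]
    = [set w | all (fun k => ~~ contaminated_run
        (take m (drop k (block X 0 N w)))) (iota 0 n)]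
      `&` ~` [set w | contaminated_run (block X n m w)].
  apply/seteqP; split=> w /=; rewrite all_cat /= add0n block_window // andbT.
    by case/andP => -> /negP.
  by case=> -> /negP.
apply: measurableI.
  by apply: IHn; apply: leq_trans nm; rewrite leq_add2r leq_pred.
by apply: measurableC; exact: measurable_contaminated_run.
Qed.

(** The hitting time is a natural number or [+oo], so exceeding [y] means exceeding its integer part
    [n + m]; the windows completed by then are those starting at [0, ..., n]. *)
Lemma hitting_time_gtP (m n : nat) (y : R) w : 0 <= y ->
  Num.truncn y = (n + m)%N ->
  (y%:E < hitting_time X m w)%E = run_free m n.+1 (block X 0 (n + m) w).
Proof.
move=> y0 yE; apply/idP/idP => [yh|/allP rf].
  apply/allP => k; rewrite mem_iota add0n ltnS => /= kn.
  rewrite block_window ?leq_add2r //; apply: contraTN yh => run.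
  rewrite -leNgt; apply: (@le_trans _ _ (k + m)%:R%:E).
    apply: ereal_inf_lbound; exists (k + m)%N => //.
    by rewrite /= leq_addl addnK.
  rewrite lee_fin -truncn_ge_nat // yE leq_add2r //.
apply: (@lt_le_trans _ _ (n + m).+1%:R%:E).
  by rewrite lte_fin -yE truncnS_gt.
apply: le_ereal_inf_tmp => _ [j [mj run] <-].
rewrite lee_fin ler_nat ltnNge; apply/negP => jnm.
have := rf (j - m)%N; rewrite mem_iota add0n ltnS leq_subLR [(m + n)%N]addnC.
move=> /(_ jnm); rewrite block_window ?run //.
by rewrite leq_add2r leq_subLR addnC.
Qed.

Lemma hitting_time_scaled_prob (m n : nat) (a x c : R) :
  c = a * fine (P (event_A1 X m)) -> 0 < c -> 0 <= x ->
  Num.truncn (x / c) = (n + m)%N ->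
  P [set w | (x%:E < hitting_time X m w * a%:E * P (event_A1 X m))%E]
    = (word_prob p q1 q2 (n + m) (run_free m n.+1))%:E.
Proof.
move=> cE c0 x0 nE; have y0 : 0 <= x / c by rewrite divr_ge0 // ltW.
rewrite -block_letters_prob; last exact: measurable_run_free.
have PE : P (event_A1 X m) = (fine (P (event_A1 X m)))%:E.
  by rewrite fineK // fin_num_measure //; exact: measurable_contaminated_run.
congr (P _); apply/seteqP; split=> w /=;
  by rewrite -(hitting_time_gtP _ y0 nE) EFinM lte_pdivrMr // cE EFinM -PE muleA.
Qed.

End Trials.

(** * Asymptotics *)

Section Asymptotics.
Context (R : realType) (p q1 q2 : R).
Hypotheses (p_gt0 : 0 < p) (q1_gt0 : 0 < q1) (q2_gt0 : 0 < q2).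
Hypothesis pq_sum : p + q1 + q2 = 1.

Local Notation r1 := (q1 / p).
Local Notation r2 := (q2 / p).
Local Notation prob := (word_prob p q1 q2).

(** Follows from [1 - u <= exp (- u) <= 1 / (1 + u) <= 1 - u + u ^+ 2]. *)
Lemma expRN_approx (u : R) : 0 <= u -> `|1 - u - expR (- u)| <= u ^+ 2.
Proof.
move=> u0; have lo := expR_ge1Dx (- u).
have hi : expR (- u) <= 1 - u + u ^+ 2.
  have u1 : 0 < 1 + u by lra.
  rewrite expRN; apply: (@le_trans _ _ (1 + u)^-1).
    by rewrite lef_pV2 ?posrE ?expR_gt0 // expR_ge1Dx.
  rewrite -(ler_pM2l u1) divff ?gt_eqF //.
  have -> : (1 + u) * (1 - u + u ^+ 2) = 1 + u ^+ 3 by ring.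
  by rewrite lerDl exprn_ge0.
by rewrite ler_norml; apply/andP; split; lra.
Qed.

Section FixedLength.
Variable m : nat.
Let u := prob m.+1 (clump_start m).
Let delta := 16 * m%:R * r1 * r2 * p ^+ m.

(** Each step adds the error of the recursion and that of replacing [1 - u] by [exp (- u)]; earlier
    errors are multiplied by [exp (- u) <= 1], so the total is linear in [n]. *)
Lemma clump_free_expR n :
  `|prob (n + m) (clump_free m n) - expR (- (n%:R * u))|
    <= n%:R * (m%:R * u ^+ 2 + u ^+ 2 + delta).
Proof.
have u0 : 0 <= u by exact: word_prob_ge0.
elim: n => [|n IHn].
  by rewrite !mul0r oppr0 expR0 /word_prob word_mean_cst // subrr normr0.
have -> : - (n.+1%:R * u) = - u + - (n%:R * u) by rewrite -natr1; ring.
rewrite expRD; set b := prob (n.+1 + m) _; set b' := prob (n + m) _ in IHn.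
set e := expR (- u); set f := expR _ in IHn *.
have -> : b - e * f = (b - (1 - u) * b') + (1 - u - e) * b' + e * (b' - f) by ring.
have e0 : 0 <= e by exact: expR_ge0.
have e1 : e <= 1 by rewrite /e -expR0 ler_expR; lra.
have b0 : 0 <= b' by exact: word_prob_ge0.
have b1 : b' <= 1 by exact: word_prob_le1.
have H1 : `|b - (1 - u) * b'| <= m%:R * u ^+ 2 + delta by exact: clump_free_recursion.
have H2 : `|(1 - u - e) * b'| <= u ^+ 2.
  rewrite normrM (ger0_norm b0) -[leRHS]mulr1.
  by rewrite ler_pM // expRN_approx.
have H3 : `|e * (b' - f)| <= `|b' - f|.
  by rewrite normrM (ger0_norm e0) ler_piMl.
apply: le_trans (ler_normD _ _) _; apply: le_trans (lerD (ler_normD _ _) (lexx _)) _.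
rewrite -natr1; lra.
Qed.

Lemma run_free_expR n : (0 < m)%N ->
  `|prob (n + m) (run_free m n.+1) - expR (- (n%:R * u))|
    <= n%:R * (m%:R * u ^+ 2 + u ^+ 2 + delta)
       + prob m (@contaminated_run R) + n.+1%:R * prob m (@sparse R).
Proof.
move=> m0; have := clump_free_expR n.
have := run_free_prob_le p_gt0 q1_gt0 q2_gt0 m n.
have := run_free_prob_ge p_gt0 q1_gt0 q2_gt0 pq_sum n m0.
have a0 : 0 <= prob m (@contaminated_run R) by exact: word_prob_ge0.
have s0 : 0 <= n.+1%:R * prob m (@sparse R) by rewrite mulr_ge0 // word_prob_ge0.
move=> H1 H2; rewrite !ler_norml => /andP[H3 H4]; apply/andP; split; lra.
Qed.
End FixedLength.

(** * Limits of the rates as the run length grows *)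

Lemma cvg_near_eq (f g : nat -> R) (l : R) :
  (\forall m \near \oo, f m = g m) -> g @ \oo --> l -> f @ \oo --> l.
Proof.
move=> fg gl; apply: cvg_trans gl; apply: near_eq_cvg.
by apply: filterS fg => m ->.
Qed.

Lemma squeeze_cst_cvgr (f h : nat -> R) (l : R) :
  h @ \oo --> l -> (\forall m \near \oo, l <= f m <= h m) -> f @ \oo --> l.
Proof. by move=> hl fh; exact: (squeeze_cvgr fh (cvg_cst l) hl). Qed.

Lemma cvg_invn : (fun m : nat => (m%:R : R)^-1) @ \oo --> (0 : R).
Proof.
have npos : \forall m \near \oo, 0 < (m%:R : R).
  by near=> m; rewrite ltr0n; near: m; exact: nbhs_infty_gt.
exact: (proj2 (gtr0_cvgV0 npos) cvgr_idn).
Unshelve. all: by end_near. Qed.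

Lemma p_lt1 : p < 1.
Proof. by move: pq_sum q1_gt0 q2_gt0 => E H1 H2; lra. Qed.

(** Writing [p ^+ m] as [exp (- l m)] and using [exp y >= y ^+ 4 / 4!] leaves a bound of order
    [1 / m]. *)
Lemma cvg_cube_geometric :
  (fun m : nat => m%:R ^+ 3 * p ^+ m) @ \oo --> (0 : R).
Proof.
pose l := - ln p; have l0 : 0 < l by rewrite oppr_gt0 ln_lt0 // p_gt0 p_lt1.
pose proof (cvgM (cvg_cst (4`!%:R / l ^+ 4)) cvg_invn) as up; rewrite mulr0 in up.
refine (squeeze_cst_cvgr up _).
near=> m; have m0 : 0 < m%:R :> R by rewrite ltr0n; near: m; exact: nbhs_infty_gt.
rewrite mulr_ge0 ?exprn_ge0 //; last exact: ltW.
have -> : p ^+ m = (expR (l * m%:R))^-1.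
  by rewrite -expRN -mulNr opprK expRM_natr lnK.
have lm : 0 < l * m%:R by rewrite mulr_gt0.
have := expR_ge1Dxn 3 (ltW lm).
set E := expR _ => HE.
have E0 : 0 < (l * m%:R) ^+ 4 / 4`!%:R by rewrite divr_gt0 ?exprn_gt0 // ltr0n.
apply: (@le_trans _ _ (m%:R ^+ 3 * ((l * m%:R) ^+ 4 / 4`!%:R)^-1)).
  apply: ler_wpM2l; first by rewrite exprn_ge0 // ltW.
  by rewrite lef_pV2 ?posrE ?expR_gt0 //; lra.
rewrite le_eqVlt; apply/orP; left; apply/eqP => /=.
by field; rewrite !gt_eqF // ltr0n.
Unshelve. all: by end_near. Qed.

(** For [m >= 2] this is [1 / (m - 1)], expressed through [1 / m]. *)
Lemma cvg_invn_div : (fun m : nat => m%:R^-1 / (1 - m%:R^-1)) @ \oo --> (0 : R).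
Proof.
have -> : 0 = 0 / (1 - 0) :> R by rewrite mul0r.
apply: cvgM; first exact: cvg_invn.
apply: cvgV; first by rewrite subr0 oner_eq0.
by apply: cvgB; [exact: cvg_cst|exact: cvg_invn].
Qed.

(** The probability that a window has exactly one [1] and one [-1]; the other rates are measured
    against it, [u m] being that of a clump start. *)
Let v (m : nat) : R := m%:R * (m%:R - 1) * r1 * r2 * p ^+ m.
Let u (m : nat) : R := (1 - p) * v m.
Let s (m : nat) := prob m (@sparse R).
Let a (m : nat) := prob m (@contaminated_run R).
Let delta (m : nat) : R := 16 * m%:R * r1 * r2 * p ^+ m.

Lemma near_rate_gt0 : \forall m \near \oo, 0 < v m.
Proof.
near=> m; have m1 : (1 < m)%N by near: m; exact: nbhs_infty_gt.
have m0 : 0 < m%:R :> R by rewrite ltr0n ltnW.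
by rewrite /v !mulr_gt0 ?invr_gt0 ?exprn_gt0 // subr_gt0 ltr1n.
Unshelve. all: by end_near. Qed.

Lemma cvg_rate_muln : (fun m => m%:R * v m) @ \oo --> (0 : R).
Proof.
pose proof (cvgM (cvg_cst (r1 * r2)) cvg_cube_geometric) as up; rewrite mulr0 in up.
refine (squeeze_cst_cvgr up _).
near=> m; have v0 : 0 < v m by near: m; exact: near_rate_gt0.
rewrite mulr_ge0 //=; last exact: ltW.
rewrite -subr_ge0 /v [X in 0 <= X](_ : _ = m%:R ^+ 2 * (r1 * r2 * p ^+ m)); last ring.
by rewrite !mulr_ge0 ?exprn_ge0 ?invr_ge0 // ltW.
Unshelve. all: by end_near. Qed.

Lemma cvg_rate : v @ \oo --> (0 : R).
Proof.
refine (squeeze_cst_cvgr cvg_rate_muln _).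
near=> m; have v0 : 0 < v m by near: m; exact: near_rate_gt0.
apply/andP; split; first exact: ltW.
apply: ler_peMl; first exact: ltW.
rewrite ler1n.
by near: m; exact: nbhs_infty_gt.
Unshelve. all: by end_near. Qed.

Lemma cvg_overlap_ratio : (fun m => delta m / v m) @ \oo --> (0 : R).
Proof.
pose proof (cvgM (cvg_cst (16 : R)) cvg_invn_div) as up; rewrite mulr0 in up.
apply: cvg_near_eq up; near=> m.
have v0 : 0 < v m by near: m; exact: near_rate_gt0.
have m1 : (1 < m)%N by near: m; exact: nbhs_infty_gt.
have mR : (1 : R) < m%:R by rewrite ltr1n.
rewrite /delta /v /=; field.
rewrite !gt_eqF ?exprn_gt0 //; lra.
Unshelve. all: by end_near. Qed.

Lemma cvg_sparse_ratio : (fun m => s m / v m) @ \oo --> (0 : R).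
Proof.
pose proof (cvgM (cvgD (cvgM cvg_invn cvg_invn_div)
  (cvgM (cvg_cst (r1 + r2)) cvg_invn_div)) (cvg_cst (r1 * r2)^-1)) as up.
rewrite !mulr0 addr0 mul0r in up; refine (squeeze_cst_cvgr up _).
near=> m; have v0 : 0 < v m by near: m; exact: near_rate_gt0.
have m1 : (1 < m)%N by near: m; exact: nbhs_infty_gt.
have mR : (1 : R) < m%:R by rewrite ltr1n.
rewrite divr_ge0 ?word_prob_ge0 ?(ltW v0) //=.
rewrite ler_pdivrMr //; apply: le_trans (sparse_prob p_gt0 q1_gt0 q2_gt0 m) _.
rewrite le_eqVlt; apply/orP; left; apply/eqP; rewrite /v fctE /=; field.
rewrite !gt_eqF //; lra.
Unshelve. all: by end_near. Qed.

Lemma cvg_contaminated_ratio : (fun m => a m / v m) @ \oo --> (1 : R).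
Proof.
pose proof (cvgD (cvg_cst (1 : R)) cvg_sparse_ratio) as up; rewrite addr0 in up.
refine (squeeze_cst_cvgr up _).
near=> m; have v0 : 0 < v m by near: m; exact: near_rate_gt0.
have := contaminated_run_prob_bounds p_gt0 q1_gt0 q2_gt0 m.
rewrite word_prob_type11 // -/(v m) -/(a m) -/(s m) => /andP[va av].
rewrite ler_pdivlMr // mul1r va /= ler_pdivrMr //.
by rewrite mulrDl mul1r divfK ?gt_eqF.
Unshelve. all: by end_near. Qed.

(** Only [C0] survives in the limit; it is the probability of a nonzero letter, the factor that
    distinguishes [u] from [v]. *)
Lemma cvg_alpha : alpha p q1 q2 @ \oo --> 1 - p.
Proof.
pose I (m : nat) : R := m%:R^-1.
pose K (m : nat) : R := m%:R^-1 / (1 - m%:R^-1).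
have num : (fun m => q1 + q2 + C1 p q1 q2 * I m + C2 p q1 q2 * (I m * K m))
    @ \oo --> q1 + q2 + C1 p q1 q2 * 0 + C2 p q1 q2 * (0 * 0).
  apply: cvgD; [apply: cvgD; [exact: cvg_cst|]|];
    apply: cvgM => //; try exact: cvg_cst.
    exact: cvg_invn.
  by apply: cvgM; [exact: cvg_invn|exact: cvg_invn_div].
have den : (fun m => 1 + p * (1 - p) / (q1 * q2) * K m
      + p ^+ 2 / (q1 * q2) * (I m * K m))
    @ \oo --> 1 + p * (1 - p) / (q1 * q2) * 0 + p ^+ 2 / (q1 * q2) * (0 * 0).
  apply: cvgD; [apply: cvgD; [exact: cvg_cst|]|];
    apply: cvgM => //; try exact: cvg_cst.
    exact: cvg_invn_div.
  by apply: cvgM; [exact: cvg_invn|exact: cvg_invn_div].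
have den0 : 1 + p * (1 - p) / (q1 * q2) * 0 + p ^+ 2 / (q1 * q2) * (0 * 0) != 0.
  by rewrite !mulr0 !addr0 oner_eq0.
pose proof (cvgM num (cvgV den0 den)) as up.
rewrite !mulr0 !addr0 invr1 mulr1 in up.
have <- : q1 + q2 = 1 - p by move: pq_sum => E; lra.
apply: cvg_near_eq up; near=> m.
have m1 : (1 < m)%N by near: m; exact: nbhs_infty_gt.
have mR : (1 : R) < m%:R by rewrite ltr1n.
rewrite /alpha /C0 /I /K /=.
have mN : m%:R != 0 :> R by rewrite gt_eqF //; lra.
have mN1 : m%:R - 1 != 0 :> R by rewrite gt_eqF //; lra.
have E1 : m%:R^-1 / (1 - m%:R^-1) = (m%:R - 1)^-1 :> R.
  by field; rewrite mN mN1.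
rewrite E1; congr (_ / _).
  by rewrite invfM.
congr (_ + _ + _); by rewrite !invfM; ring.
Unshelve. all: by end_near. Qed.

(** The normalization of the theorem, asymptotically equivalent to [u m]. *)
Let c (m : nat) : R := alpha p q1 q2 m * a m.

Lemma cvg_scale_ratio : (fun m => c m / v m) @ \oo --> 1 - p.
Proof.
pose proof (cvgM cvg_alpha cvg_contaminated_ratio) as up; rewrite mulr1 in up.
by apply: cvg_near_eq up; near=> m; rewrite /c /= mulrA.
Unshelve. all: by end_near. Qed.

Lemma near_scale_gt0 : \forall m \near \oo, 0 < c m.
Proof.
near=> m; have v0 : 0 < v m by near: m; exact: near_rate_gt0.
suff : 0 < c m / v m by rewrite pmulr_lgt0 ?invr_gt0.
near: m; apply: (cvgr_gt _ cvg_scale_ratio).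
by rewrite subr_gt0 p_lt1.
Unshelve. all: by end_near. Qed.

(** * Passage to the limit at a fixed level *)

Section Level.
Variable x : R.
Hypothesis x_gt0 : 0 < x.

(** The event of the theorem says that none of the first [N m] trials completes a run. The truncated
    difference [n m] is exact once [m <= N m], which holds eventually because [m * c m] tends to
    0. *)
Let N (m : nat) := Num.truncn (x / c m).
Let n (m : nat) := (N m - m)%N.

Lemma near_level_ge : \forall m \near \oo, (m <= N m)%N.
Proof.
pose proof (cvgM cvg_rate_muln cvg_scale_ratio) as mc; rewrite mul0r in mc.
near=> m; have c0 : 0 < c m by near: m; exact: near_scale_gt0.
have v0 : 0 < v m by near: m; exact: near_rate_gt0.
rewrite /N truncn_ge_nat; last by rewrite divr_ge0 // ltW.
rewrite ler_pdivlMr //.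
have -> : m%:R * c m = m%:R * v m * (c m / v m) by field; rewrite gt_eqF.
by apply: ltW; near: m; exact: (cvgr_lt _ mc).
Unshelve. all: by end_near. Qed.

(** The product [x / c m * u m] tends to [x]; rounding down to [N m] costs at most [u m] and
    subtracting [m] costs [m * u m], both of which vanish. *)
Lemma cvg_level_rate : (fun m => (n m)%:R * u m) @ \oo --> x.
Proof.
have q0 : 0 < 1 - p by rewrite subr_gt0 p_lt1.
have uc : (fun m => x * ((1 - p) * (c m / v m)^-1)) @ \oo --> x.
  have {2}-> : x = x * ((1 - p) * (1 - p)^-1) by rewrite divff ?mulr1 // gt_eqF.
  apply: cvgM; first exact: cvg_cst.
  apply: cvgM; first exact: cvg_cst.
  by apply: cvgV; [rewrite gt_eqF|exact: cvg_scale_ratio].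
have lo : (fun m => x * ((1 - p) * (c m / v m)^-1) - (1 - p) * (v m + m%:R * v m))
    @ \oo --> x.
  have {2}-> : x = x - (1 - p) * (0 + 0) by rewrite addr0 mulr0 subr0.
  apply: cvgB; first exact: uc.
  apply: cvgM; first exact: cvg_cst.
  by apply: cvgD; [exact: cvg_rate|exact: cvg_rate_muln].
refine (squeeze_cvgr _ lo uc).
near=> m; have c0 : 0 < c m by near: m; exact: near_scale_gt0.
have v0 : 0 < v m by near: m; exact: near_rate_gt0.
have mN : (m <= N m)%N by near: m; exact: near_level_ge.
have u0 : 0 < u m by rewrite mulr_gt0.
have /truncn_itv /andP[] : 0 <= x / c m by rewrite divr_ge0 // ltW.
rewrite -/(N m) -natr1 => N1 N2.
have -> : x * ((1 - p) * (c m / v m)^-1) = x / c m * u m.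
  by rewrite /u; field; rewrite !gt_eqF.
rewrite natrB // [(_ - m%:R) * _]mulrBl.
have H1 : (N m)%:R * u m <= x / c m * u m by rewrite ler_pM2r.
have H2 : x / c m * u m <= ((N m)%:R + 1) * u m by rewrite ler_pM2r // ltW.
have H3 : 0 <= m%:R * u m by rewrite mulr_ge0 // ltW.
rewrite mulrDl mul1r in H2.
have -> : (1 - p) * (v m + m%:R * v m) = u m + m%:R * u m by rewrite /u; ring.
by apply/andP; split; lra.
Unshelve. all: by end_near. Qed.

Lemma cvg_run_free_prob :
  (fun m => prob (n m + m) (run_free m (n m).+1)) @ \oo --> expR (- x).
Proof.
have q0 : 0 < 1 - p by rewrite subr_gt0 p_lt1.
(* The error of [run_free_expR], rearranged with [u m = (1 - p) * v m] so that [n m] occurs only in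
   the convergent product [n m * u m] and all other factors have known limits. *)
pose err m := (n m)%:R * u m * ((1 - p) * (m%:R * v m) + (1 - p) * v m
      + (1 - p)^-1 * (delta m / v m))
    + v m * (a m / v m)
    + ((n m)%:R * u m + (1 - p) * v m) * ((1 - p)^-1 * (s m / v m)).
have err0 : err @ \oo --> (0 : R).
  have -> : 0 = x * ((1 - p) * 0 + (1 - p) * 0 + (1 - p)^-1 * 0) + 0 * 1
    + (x + (1 - p) * 0) * ((1 - p)^-1 * 0) :> R by ring.
  have cM (k : R) (f : nat -> R) (l : R) :
    f @ \oo --> l -> (fun m => k * f m) @ \oo --> k * l.
    by move=> fl; apply: cvgM => //; exact: cvg_cst.
  apply: cvgD; first apply: cvgD.
  - apply: cvgM; first exact: cvg_level_rate.
    apply: cvgD; last exact: (cM _ _ _ cvg_overlap_ratio).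
    by apply: cvgD; [exact: (cM _ _ _ cvg_rate_muln)|exact: (cM _ _ _ cvg_rate)].
  - by apply: cvgM; [exact: cvg_rate|exact: cvg_contaminated_ratio].
  - apply: cvgM; last exact: (cM _ _ _ cvg_sparse_ratio).
    by apply: cvgD; [exact: cvg_level_rate|exact: (cM _ _ _ cvg_rate)].
have el : (fun m => expR (- ((n m)%:R * u m))) @ \oo --> expR (- x).
  apply: continuous_cvg; first exact: continuous_expR.
  by apply: cvgN; exact: cvg_level_rate.
have lo : (fun m => expR (- ((n m)%:R * u m)) - err m) @ \oo --> expR (- x).
  by rewrite -[expR (- x)]subr0; apply: cvgB.
have hi : (fun m => expR (- ((n m)%:R * u m)) + err m) @ \oo --> expR (- x).
  by rewrite -[expR (- x)]addr0; apply: cvgD.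
refine (squeeze_cvgr _ lo hi).
near=> m; have v0 : 0 < v m by near: m; exact: near_rate_gt0.
have m0 : (0 < m)%N by near: m; exact: nbhs_infty_gt.
have uE : prob m.+1 (clump_start m) = u m by rewrite word_prob_clump_start.
have := run_free_expR (n m) m0; rewrite uE -/(a m) -/(s m) -/(delta m).
have -> : (n m)%:R * (m%:R * u m ^+ 2 + u m ^+ 2 + delta m) + a m + (n m).+1%:R * s m
    = err m.
  by rewrite /err /u -natr1; field; rewrite !gt_eqF.
by rewrite ler_norml => /andP[H1 H2]; apply/andP; split; lra.
Unshelve. all: by end_near. Qed.
End Level.
End Asymptotics.

Theorem theorem2p1 (R : realType) (d : measure_display) (T : measurableType d)
  (P : probability T R) (p q1 q2 : R) (X : nat -> {RV P >-> R})
  (p_gt0 : 0 < p) (q1_gt0 : 0 < q1) (q2_gt0 : 0 < q2)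
  (pq_sum : p + q1 + q2 = 1)
  (X_indep : mutually_independent X)
  (X_0 : forall i, P (X i @^-1` [set 0]) = p%:E)
  (X_p1 : forall i, P (X i @^-1` [set 1]) = q1%:E)
  (X_m1 : forall i, P (X i @^-1` [set -1]) = q2%:E)
  (x : R) (x_gt0 : 0 < x) :
  (fun m : nat =>
     fine (P [set w | (x%:E < hitting_time X m w * (alpha p q1 q2 m)%:E
                              * P (event_A1 X m))%E])
     / expR (- x)) @ \oo --> (1 : R).
Proof.
have -> : 1 = expR (- x) * (expR (- x))^-1 :> R by rewrite divff ?gt_eqF ?expR_gt0.
apply: cvgM; last exact: cvg_cst.
apply: cvg_near_eq (cvg_run_free_prob p_gt0 q1_gt0 q2_gt0 pq_sum x_gt0).
near=> m.
have c0 : 0 < alpha p q1 q2 m * word_prob p q1 q2 m (@contaminated_run R).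
  by near: m; exact: near_scale_gt0.
have mN : (m <= Num.truncn (x / (alpha p q1 q2 m
    * word_prob p q1 q2 m (@contaminated_run R))))%N.
  by near: m; exact: near_level_ge.
rewrite (hitting_time_scaled_prob pq_sum X_indep X_0 X_p1 X_m1 _ c0 (ltW x_gt0)
  (esym (subnK mN))) //.
by rewrite (event_A1_prob pq_sum X_indep X_0 X_p1 X_m1).
Unshelve. all: by end_near. Qed.
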